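(* Let $(X,d,\mu)$ be an irreversible metric measure space. Then $(X,d,\mu)$ has exponential concentration, i.e. there are positive constants $C$ and $c$ such that $\alpha_{(X,d,\mu)}(r)\le C e^{-cr}$ for every $r>0$, if and only if there are positive constants $C'$ and $c'$ such that for every 1-Lipschitz function $f$ on $(X,d,\mu)$ and every $r>0$, $$\mu\left(\left\{x\in X \;\middle|\; \left|f(x)-\int_X f\,d\mu\right|\ge r\right\}\right)\le C' e^{-c' r}.$$ Here $C'=C'(C)$ and $c'=c'(c)$ are constants ($C'$ depending on $C$, and $c'$ depending on $c$).
   Context: An irreversible metric space $(X,d)$ is a set $X$ with a function $d:X\times X\to[0,\infty)$ such that $d(x_1,x_2)=0$ if and only if $x_1=x_2$, and $d(x_1,x_3)\le d(x_1,x_2)+d(x_2,x_3)$ for all $x_1,x_2,x_3\in X$ ($d$ need not be symmetric). An irreversible metric measure space $(X,d,\mu)$ is an irreversible metric space endowed with a Borel probability measure $\mu$. For $A\subset X$ and $r>0$ put $B^{+}(A,r)=\{x\in X\mid \inf_{z\in A}d(z,x)<r\}$ and $B^{-}(A,r)=\{x\in X\mid \inf_{z\in A}d(x,z)<r\}$. The concentration function is $$\alpha_{(X,d,\mu)}(r)=\sup\left\{1-\min\{\mu(B^{+}(A,r)),\mu(B^{-}(A,r))\}\;\middle|\; A\subset X \text{ Borel},\ \mu(A)\ge \tfrac12\right\},\quad r>0.$$ A function $f:X\to\mathbb{R}$ is $L$-Lipschitz ($L>0$) if $f(z)-f(x)\le L\,d(x,z)$ for all $x,z\in X$. The sets $B^{\pm}(A,r)$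 and Lipschitz functions are understood to be measurable, so that the expressions above make sense. *)

(* Defs.v *)
From HB Require Import structures.
From mathcomp Require Import all_boot all_order all_algebra.
From mathcomp Require Import all_classical all_reals all_analysis.

Set Implicit Arguments.
Unset Strict Implicit.
Unset Printing Implicit Defensive.

Import Order.TTheory GRing.Theory Num.Theory.
Import numFieldNormedType.Exports.

Local Open Scope classical_set_scope.
Local Open Scope ring_scope.

Definition irreversible_metric (R : realType) (T : Type) (d : T -> T -> R) :
    Prop :=
  [/\ forall x y, 0 <= d x y,
      forall x y, d x y = 0 <-> x = y &
      forall x y z, d x z <= d x y + d y z].

Definition forward_ball (R : realType) (T : Type) (d : T -> T -> R)
    (x : T) (r : R) : set T := [set y | d x y < r].

Definition backward_ball (R : realType) (T : Type) (d : T -> T -> R)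
    (x : T) (r : R) : set T := [set y | d y x < r].

Definition ball_open (R : realType) (T : Type) (b : T -> R -> set T) :
    set (set T) :=
  [set U | forall x, U x -> exists2 r : R, 0 < r & b x r `<=` U].

(* Without symmetry, d induces three natural topologies (from forward balls,
   from backward balls, from both), which need not coincide.  "Borel" may refer
   to any of them, so all three are allowed. *)
Definition irreversible_metric_topology (R : realType) (T : topologicalType)
    (d : T -> T -> R) : Prop :=
  [\/ @open T = ball_open (forward_ball d),
      @open T = ball_open (backward_ball d) |
      @open T = ball_open (fun x r => forward_ball d x r `&` backward_ball d x r)].

(* The infima are taken in \bar R, so that the infimum over the empty set is
   +oo and both neighbourhoods of the empty set are empty. *)
Definition Bplus (R : realType) (T : Type) (d : T -> T -> R)
    (A : set T) (r : R) : set T :=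
  [set x | (ereal_inf [set (d z x)%:E | z in A] < r%:E)%E].

Definition Bminus (R : realType) (T : Type) (d : T -> T -> R)
    (A : set T) (r : R) : set T :=
  [set x | (ereal_inf [set (d x z)%:E | z in A] < r%:E)%E].

Definition irreversible_lipschitz (R : realType) (T : Type) (d : T -> T -> R)
    (L : R) (f : T -> R) : Prop :=
  forall x z, f z - f x <= L * d x z.

Definition measurable_neighbourhoods (R : realType) (T : ptopologicalType)
    (d : T -> T -> R) : Prop :=
  forall (A : set (g_sigma_algebraType (@open T))) (r : R),
    measurable A -> 0 < r ->
    measurable (Bplus d A r : set (g_sigma_algebraType (@open T))) /\
    measurable (Bminus d A r : set (g_sigma_algebraType (@open T))).

Definition measurable_lipschitz (R : realType) (T : ptopologicalType)
    (d : T -> T -> R) : Prop :=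
  forall (L : R) (f : g_sigma_algebraType (@open T) -> R),
    0 < L -> irreversible_lipschitz d L f -> measurable_fun setT f.

Definition concentration_function (R : realType) (T : ptopologicalType)
    (d : T -> T -> R) (mu : probability (g_sigma_algebraType (@open T)) R)
    (r : R) : \bar R :=
  ereal_sup [set (1 - Order.min (mu (Bplus d A r)) (mu (Bminus d A r)))%E
            | A in [set A : set (g_sigma_algebraType (@open T)) |
                    measurable A /\ ((2^-1)%:E <= mu A)%E]].

Definition exponential_concentration (R : realType) (T : ptopologicalType)
    (d : T -> T -> R) (mu : probability (g_sigma_algebraType (@open T)) R)
    (C c : R) : Prop :=
  forall r : R, 0 < r ->
    (concentration_function d mu r <= (C * expR (- (c * r)))%:E)%E.

(* Integrability is what makes the mean of f meaningful: the real-valued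
   integral of a non-integrable function is a default value. *)
Definition lipschitz_deviation (R : realType) (T : ptopologicalType)
    (d : T -> T -> R) (mu : probability (g_sigma_algebraType (@open T)) R)
    (C c : R) : Prop :=
  forall f : g_sigma_algebraType (@open T) -> R,
    irreversible_lipschitz d 1 f ->
    mu.-integrable setT (EFin \o f) /\
    forall r : R, 0 < r ->
      (mu [set x | (r <= `|f x - \int[mu]_y f y|)%R]
         <= (C * expR (- (c * r)))%:E)%E.

(* Main.v *)
(* If m is a median of a 1-Lipschitz f, then f < m + r on B+({f <= m}, r) and
   f > m - r on B-({f >= m}, r), so concentration gives
   mu {|f - m| >= r} <= 2 C e^(-c r).  Integrating this tail,
   |E f - m| <= (2 C + 1) / c, and moving the centre from m to E f multiplies
   the bound by e^(2 C + 1) without changing the rate.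
   Conversely, x |-> inf_(z in A) d(z, x) and x |-> - inf_(z in A) d(x, z) are
   1-Lipschitz and vanish on A; since mu A >= 1/2, their means are at most
   ln (2 K) / k in absolute value, and the same change of centre applies. *)
Require Import Defs.
From HB Require Import structures.
From mathcomp Require Import all_boot all_order all_algebra.
From mathcomp Require Import all_classical all_reals all_analysis.
From mathcomp Require Import measurable_realfun lra.
Import Order.TTheory GRing.Theory Num.Theory.
Import numFieldNormedType.Exports.
Local Open Scope classical_set_scope.
Local Open Scope ring_scope.

(** * Medians and exponential tails on a probability space *)

Section RealFunctions.
Context {disp : measure_display} {T : measurableType disp} {R : realType}.
Implicit Types (f g : T -> R) (P : probability T R).

Lemma measurable_ler_fun f g : measurable_fun setT f -> measurable_fun setT g ->
  measurable [set x | f x <= g x].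
Proof.
move=> mf mg; rewrite -[X in measurable X]setTI.
exact: (measurable_fun_le measurableT mf mg).
Qed.

(** Bundling [f] as a random variable gives access to the theory of [cdf], [ccdf] and
    expectation. *)
Lemma measurable_RV P f : measurable_fun setT f ->
  exists X : {RV P >-> R}, (X : T -> R) = f.
Proof.
move=> mf; pose h := isMeasurableFun.Build _ _ _ _ f mf.
by exists (HB.pack f h : {RV P >-> R}).
Qed.

(** Let [t] decrease to [m] and use right continuity of the cdf. *)
Lemma probability_le_right P f (m p : R) : measurable_fun setT f ->
  (forall t, m < t -> (p%:E <= P [set x | (f x <= t)%R])%E) ->
  (p%:E <= P [set x | (f x <= m)%R])%E.
Proof.
move=> /(measurable_RV P)[X <-] ht.
have cE t : P [set x | (X x <= t)%R] = cdf X t by [].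
rewrite cE; apply: (cvge_to_ge (@cdf_right_continuous _ _ _ _ X m)).
by near=> t; rewrite -cE; apply: ht; near: t; exact: nbhs_right_gt.
Unshelve. all: by end_near. Qed.

(** The median is the infimum of the set [S] of levels where the cdf is at least 1/2. *)
Lemma exists_median P f : measurable_fun setT f ->
  exists m : R, ((2^-1)%:E <= P [set x | (f x <= m)%R])%E /\
                ((2^-1)%:E <= P [set x | (m <= f x)%R])%E.
Proof.
move=> mf; have [X XE] := measurable_RV P f mf.
have cE t : P [set x | (f x <= t)%R] = cdf X t.
  by rewrite -XE.
have mle t : measurable [set x | f x <= t] by exact: measurable_ler_fun.
pose S := [set t : R | ((2^-1)%:E <= P [set x | (f x <= t)%R])%E].
have S0 : S !=set0.
  (* If [S] were empty, the cdf would stay below 1/2, yet it tends to 1 at +oo. *)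
  apply: contrapT => noS.
  suff : (1 <= (2^-1)%:E :> \bar R)%E by rewrite lee_fin; lra.
  apply: (cvge_to_le (@cvg_cdfy1 _ _ _ _ X)); apply: nearW => t.
  rewrite -cE leNgt; apply/negP => /ltW ht.
  by apply: noS; exists t.
have lbS : has_lbound S.
  (* A level outside [S] bounds [S] from below by monotonicity. So if [S] were unbounded below, the
     cdf would be at least 1/2 everywhere, yet it tends to 0 at -oo. *)
  apply: contrapT => noS.
  suff : ((2^-1)%:E <= 0 :> \bar R)%E by rewrite lee_fin; lra.
  apply: (cvge_to_ge (@cvg_cdfNy0 _ _ _ _ X)); apply: nearW => t.
  rewrite -cE; apply: contrapT => ht; apply: noS; exists t => s Ss.
  rewrite leNgt; apply/negP => st; apply: ht.
  apply: (le_trans Ss); apply: le_measure; rewrite ?inE// => x /= fs.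
  exact: le_trans fs (ltW st).
have infS t : t < inf S -> (P [set x | (f x <= t)%R] < (2^-1)%:E)%E.
  move=> tS; rewrite ltNge; apply/negP => St.
  by move: tS; rewrite ltNge (ge_inf lbS).
exists (inf S); split.
  apply: probability_le_right => // t /(inf_lt S0)[s Ss st].
  apply: (le_trans Ss); apply: le_measure; rewrite ?inE// => x /= fs.
  exact: le_trans fs (ltW st).
(* The upper half is right continuity again, applied to [- f]: for [t > - inf S] the level [- t] is
   not in [S], so the complement of [f <= - t] has mass at least 1/2. *)
rewrite [X in P X](_ : _ = [set x | - f x <= - inf S]); last first.
  by apply/seteqP; split => x /=; rewrite lerN2.
apply: probability_le_right; first exact: measurableT_comp.
move=> t St.
have := infS (- t); rewrite ltrNl => /(_ St) /ltW ht.
have mt : measurable [set x | f x <= - t] by [].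
rewrite (@le_trans _ _ (P (~` [set x | (f x <= - t)%R])))//.
  rewrite probability_setC// leeBrDr// ?fin_num_measure//.
  rewrite (@le_trans _ _ ((2^-1)%:E + (2^-1)%:E)%E)// ?leeD2l//.
  by rewrite -EFinD lee_fin; lra.
apply: le_measure; rewrite ?inE//.
- exact: measurableC.
- by apply: measurable_ler_fun => //; exact: measurableT_comp.
- by move=> x /= /negP; rewrite -ltNge lerNl => /ltW.
Qed.

(** The mean is the integral of the tail over [0, +oo[. The tail bound is K / k times the density of
    the exponential law of rate k, whose total mass is 1. *)
Lemma ge0_integral_exp_tail P f (K k : R) : measurable_fun setT f ->
  0 <= K -> 0 < k -> (forall x, 0 <= f x) ->
  (forall r : R, 0 <= r -> (P [set x | (r <= f x)%R] <= (K * expR (- (k * r)))%:E)%E) ->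
  (\int[P]_x (f x)%:E <= (K / k)%:E)%E.
Proof.
move=> mf K0 k0 f0 tail; have [X XE] := measurable_RV P f mf.
have -> : (\int[P]_x (f x)%:E)%E = ('E_P[X])%E by rewrite expectation_def XE.
rewrite ge0_expectation_ccdf ?XE//.
have mpdf : measurable_fun setT (EFin \o exponential_pdf k).
  by apply/measurable_EFinP; exact: measurable_exponential_pdf.
have pdf0 x : (0 <= (exponential_pdf k x)%:E)%E.
  by rewrite lee_fin exponential_pdf_ge0// ltW.
apply: (@le_trans _ _
  (\int[lebesgue_measure]_(r in `[0%R, +oo[) ((K / k)%:E * (exponential_pdf k r)%:E)))%E.
  apply: ge0_le_integral => //.
  - by apply: measurable_funTS; exact: ccdf_measurable.
  - by apply: measurable_funTS; exact: measurable_funeM.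
  - move=> r; rewrite /= in_itv/= andbT => r0.
    rewrite exponential_pdfE// -EFinM.
    have -> : K / k * (k * expR (- k * r)) = K * expR (- (k * r)).
      by rewrite mulrA divfK ?gt_eqF// mulNr.
    apply: le_trans (tail r r0).
    rewrite /ccdf /distribution /pushforward XE.
    apply: le_measure; rewrite ?inE//.
    + by rewrite -XE -[X in measurable X]setTI; exact: measurable_funP.
    + exact: measurable_ler_fun.
    + by move=> x /=; rewrite in_itv/= andbT => /ltW.
rewrite ge0_integralZl ?lee_fin ?divr_ge0 ?(ltW k0)//; last exact: measurable_funTS.
rewrite -[leRHS]mule1 lee_wpmul2l ?lee_fin ?divr_ge0 ?(ltW k0)//.
rewrite -(integral_exponential_pdf k0).
exact: ge0_subset_integral.
Qed.

(** If r <= a, the right-hand side is at least K >= 1. Otherwise |g| >= r forces |f| >= r - a > 0,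
    and the tail of [f] applies. *)
Lemma exp_tail_shift P f g (K k a : R) :
  measurable_fun setT f -> measurable_fun setT g ->
  1 <= K -> 0 < k -> (forall x, `|f x - g x| <= a) ->
  (forall r : R, 0 < r -> (P [set x | (r <= `|f x|)%R] <= (K * expR (- (k * r)))%:E)%E) ->
  forall r : R, (P [set x | (r <= `|g x|)%R] <= (K * expR (k * a) * expR (- (k * r)))%:E)%E.
Proof.
move=> mf mg K1 k0 fg tail r.
have mtail (h : T -> R) s : measurable_fun setT h -> measurable [set x | s <= `|h x|].
  by move=> mh; apply: measurable_ler_fun => //; exact: measurableT_comp.
have -> : K * expR (k * a) * expR (- (k * r)) = K * expR (- (k * (r - a))).
  by rewrite -mulrA -expRD; congr (_ * expR _); lra.
have [ra|ar] := leP r a.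
  apply: le_trans (probability_le1 _ _) _; first exact: mtail.
  rewrite lee_fin (le_trans K1)// ler_peMr ?(le_trans ler01)//.
  by rewrite -expR0 ler_expR oppr_ge0 pmulr_rle0// subr_le0.
apply: le_trans (tail (r - a) _); last by rewrite subr_gt0.
apply: le_measure; rewrite ?inE; [exact: mtail|exact: mtail|].
move=> x /= rg; rewrite lerBlDr (le_trans rg)//.
rewrite -[X in `|X|](subKr (f x)) (le_trans (ler_normB _ _))// lerD2l.
exact: fg.
Qed.

End RealFunctions.

(** * Changing the centre of a deviation bound *)

Section Deviation.
Context {disp : measure_display} {T : measurableType disp} {R : realType}.
Implicit Types (P : probability T R) (f : T -> R).

(** The mean lies within a = K / k of [m], so the shift costs the factor e^(k a) = e^K, which does
    not depend on the rate. *)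
Lemma exp_tail_mean P f (m K k : R) : measurable_fun setT f ->
  1 <= K -> 0 < k ->
  (forall r : R, 0 < r ->
    (P [set x | (r <= `|f x - m|)%R] <= (K * expR (- (k * r)))%:E)%E) ->
  P.-integrable setT (EFin \o f) /\
  forall r : R, (P [set x | (r <= `|f x - \int[P]_y f y|)%R]
    <= (K * expR K * expR (- (k * r)))%:E)%E.
Proof.
move=> mf K1 k0 tail.
have K0 : 0 <= K by rewrite (le_trans ler01).
have mfm : measurable_fun setT (fun x => f x - m) by exact: measurable_funB.
have mnfm : measurable_fun setT (fun x => `|f x - m|) by exact: measurableT_comp.
have Ele : (\int[P]_x (`|f x - m|)%:E <= (K / k)%:E)%E.
  (* The tail hypothesis covers only r > 0; at r = 0 the bound is K >= 1, hence trivial. *)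
  apply: ge0_integral_exp_tail => // r; rewrite le_eqVlt => /predU1P[<-|]; last exact: tail.
  apply: (le_trans (probability_le1 _ _)); first exact: measurable_ler_fun.
  by rewrite mulr0 oppr0 expR0 mulr1 lee_fin.
have ifm : P.-integrable setT (EFin \o (fun x => f x - m)).
  apply/integrableP; split; first exact/measurable_EFinP.
  exact: le_lt_trans Ele (ltry _).
have im : P.-integrable setT (EFin \o (fun=> m)).
  exact: finite_measure_integrable_cst.
have if_ : P.-integrable setT (EFin \o f).
  rewrite (_ : _ \o _ = (EFin \o (fun x => (f x - m)%R)) \+ (EFin \o (fun=> m)))%E.
    exact: integrableD.
  by apply/funext => x /=; rewrite -EFinD subrK.
split=> // r.
have mean : `|\int[P]_y f y - m| <= K / k.
  have -> : \int[P]_y f y - m = \int[P]_y (f y - m).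
    rewrite RintegralB// Rintegral_cst// (_ : fine _ = 1) ?mulr1//.
    by rewrite [X in fine X]probability_setT.
  apply: (le_trans (le_normr_Rintegral measurableT ifm)).
  rewrite -lee_fin fineK ?ge0_fin_numE ?integral_ge0//.
  exact: le_lt_trans Ele (ltry _).
rewrite -[X in expR X](_ : k * (K / k) = K); last by rewrite mulrC divfK ?gt_eqF.
apply: (exp_tail_shift P (fun x => f x - m) (fun x => f x - \int[P]_y f y)) => //.
  exact: measurable_funB.
by move=> x; rewrite opprB addrC addrA subrK.
Qed.

(* On A the deviation equals |E f|, and P A >= 1/2, hence K e^(-k |E f|) >= 1/2
   and |E f| <= ln (2 K) / k. *)
Lemma exp_tail_zero_set P f (A : set T) (m K k : R) : measurable_fun setT f ->
  measurable A -> ((2^-1)%:E <= P A)%E -> (forall x, A x -> f x = 0) ->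
  1 <= K -> 0 < k ->
  (forall r : R, 0 < r ->
    (P [set x | (r <= `|f x - m|)%R] <= (K * expR (- (k * r)))%:E)%E) ->
  forall r : R, (P [set x | (r <= `|f x|)%R]
    <= (2 * K ^+ 2 * expR (- (k * r)))%:E)%E.
Proof.
move=> mf mA PA fA K1 k0 tail r.
have K0 : 0 < K by rewrite (lt_le_trans ltr01).
have mfm : measurable_fun setT (fun x => f x - m) by exact: measurable_funB.
have m_le : `|m| <= ln (2 * K) / k.
  rewrite leNgt; apply/negP => lt_m.
  have m0 : 0 < `|m|.
    apply: le_lt_trans lt_m; rewrite divr_ge0 ?(ltW k0)// ln_ge0//.
    by rewrite (le_trans K1)// ler_peMl ?ler1n// ltW.
  have : ((2^-1)%:E <= (K * expR (- (k * `|m|)))%:E)%E.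
    apply: (le_trans PA); apply: le_trans (tail _ m0).
    apply: le_measure; rewrite ?inE//.
      by apply: measurable_ler_fun => //; exact: measurableT_comp.
    by move=> x /= /fA ->; rewrite sub0r normrN.
  rewrite lee_fin leNgt => /negP; apply.
  have -> : 2^-1 = K * expR (- ln (2 * K)).
    rewrite expRN lnK ?posrE ?mulr_gt0//.
    by rewrite invfM mulrCA divff ?gt_eqF// mulr1.
  by rewrite ltr_pM2l// ltr_expR ltrN2 -ltr_pdivrMl// mulrC.
(* The shift is a = ln (2 K) / k, so its cost e^(k a) is 2 K. *)
have -> : 2 * K ^+ 2 = K * expR (k * (ln (2 * K) / k)).
  rewrite [k * _]mulrC divfK ?gt_eqF// lnK ?posrE ?mulr_gt0//.
  by rewrite expr2 mulrCA.
apply: (exp_tail_shift P (fun x => f x - m) f) => //.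
by move=> x; rewrite addrC addrA addNr add0r normrN.
Qed.

End Deviation.

(** * Asymmetric distance from a set *)

Section Distance.
Context {R : realType} {T : Type}.
Implicit Types (e D : T -> T -> R) (A : set T).

(** Real-valued, so that it can serve as a Lipschitz test function. Over the empty set this infimum
    is 0 rather than +oo, hence the nonemptiness assumptions below. Reversing the arguments of [e]
    gives the distance to [A]. *)
Definition set_dist e A x : R := inf [set e z x | z in A].

Lemma has_lbound_dist e A x : (forall x y, 0 <= e x y) ->
  has_lbound [set e z x | z in A].
Proof. by move=> e0; exists 0 => _ [z _ <-]. Qed.

Lemma Bplus_set_dist e A r x : (forall x y, 0 <= e x y) -> A !=set0 ->
  Bplus e A r x <-> set_dist e A x < r.
Proof.
move=> e0 A0; rewrite /Bplus /= -[X in ereal_inf X](image_comp (e^~ x) EFin).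
rewrite ereal_inf_EFin ?lte_fin//; first exact: has_lbound_dist.
exact: image_nonempty.
Qed.

Lemma set_dist_in e A x : (forall x y, 0 <= e x y) -> (forall x, e x x = 0) ->
  A x -> set_dist e A x = 0.
Proof.
move=> e0 exx Ax; apply/eqP; rewrite eq_le; apply/andP; split.
  by apply: (ge_inf (has_lbound_dist _ _ _ e0)); exists x.
by apply: lb_le_inf => [|_ [z _ <-]//]; exists (e x x), x.
Qed.

(** For each [z] in [A], [set_dist e A y - D x y] is at most [e z x], hence at most the infimum over
    [z]. *)
Lemma set_dist_triangle e D A x y : (forall x y, 0 <= e x y) -> A !=set0 ->
  (forall z, e z y <= e z x + D x y) ->
  set_dist e A y - set_dist e A x <= D x y.
Proof.
move=> e0 A0 tri; rewrite lerBlDr -lerBlDl.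
apply: lb_le_inf; first exact: image_nonempty.
move=> _ [z Az <-]; rewrite lerBlDl addrC.
apply: le_trans (tri z).
by apply: (ge_inf (has_lbound_dist _ _ _ e0)); exists z.
Qed.

End Distance.

(** * The two implications *)

Section Concentration.
Context {R : realType} {T : ptopologicalType} {d : T -> T -> R}.
Local Notation borel := (g_sigma_algebraType (@open T)).
Context {mu : probability borel R}.
Hypothesis d_metric : irreversible_metric d.
Hypothesis d_nbhd : measurable_neighbourhoods d.
Hypothesis d_lip : measurable_lipschitz d.

(** The number 1 - min is the larger of the two complementary masses, so it dominates this one. *)
Lemma concentration_Bplus C c (A : set borel) r : 0 < r ->
  exponential_concentration d mu C c -> measurable A ->
  ((2^-1)%:E <= mu A)%E ->
  (mu (~` Bplus d A r) <= (C * expR (- (c * r)))%:E)%E.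
Proof.
move=> r0 conc mA hA; have [mp mm] := d_nbhd A r mA r0.
rewrite (@probability_setC _ _ _ mu _ mp); apply: le_trans (conc r r0).
apply: (@le_trans _ _ (1 - Order.min (mu (Bplus d A r)) (mu (Bminus d A r)))%E).
  by rewrite leeB// ge_min lexx.
by apply: ereal_sup_ubound; exists A.
Qed.

Lemma concentration_Bminus C c (A : set borel) r : 0 < r ->
  exponential_concentration d mu C c -> measurable A ->
  ((2^-1)%:E <= mu A)%E ->
  (mu (~` Bminus d A r) <= (C * expR (- (c * r)))%:E)%E.
Proof.
move=> r0 conc mA hA; have [mp mm] := d_nbhd A r mA r0.
rewrite (@probability_setC _ _ _ mu _ mm); apply: le_trans (conc r r0).
apply: (@le_trans _ _ (1 - Order.min (mu (Bplus d A r)) (mu (Bminus d A r)))%E).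
  by rewrite leeB// ge_min lexx orbT.
by apply: ereal_sup_ubound; exists A.
Qed.

Lemma concentration_median_tail C c (f : borel -> R) :
  exponential_concentration d mu C c -> irreversible_lipschitz d 1 f ->
  exists m : R, forall r : R, 0 < r ->
    (mu [set x | (r <= `|f x - m|)%R] <= (2 * C * expR (- (c * r)))%:E)%E.
Proof.
move=> conc lipf; have mf : measurable_fun setT f := d_lip 1 f ltr01 lipf.
have [m [lem gem]] := exists_median mu f mf.
exists m => r r0.
pose A := [set x | f x <= m]; pose B := [set x | m <= f x].
have mA : measurable A by exact: measurable_ler_fun.
have mB : measurable B by exact: measurable_ler_fun.
have [mAp _] := d_nbhd A r mA r0; have [_ mBm] := d_nbhd B r mB r0.
rewrite (@le_trans _ _ (mu (~` Bplus d A r `|` ~` Bminus d B r)))//.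
  apply: le_measure; rewrite ?inE.
  - by apply: measurable_ler_fun => //; apply: measurableT_comp => //; exact: measurable_funB.
  - by apply: measurableU; exact: measurableC.
  (* Below the median, a point [z] of [B] with [d x z < r] would give [f z - f x < r], against
     [m - f x >= r]. Above it, the same argument runs from [A] to [x]. *)
  - move=> x /= rfm; have [fm|mf'] := leP (f x) m.
      right=> /ereal_inf_lt[_ [z Bz <-]]; rewrite lte_fin => dxz.
      have := lipf x z; rewrite mul1r; move: rfm Bz; rewrite /B /=.
      by rewrite ler0_norm ?subr_le0//; lra.
    left=> /ereal_inf_lt[_ [z Az <-]]; rewrite lte_fin => dzx.
    have := lipf z x; rewrite mul1r; move: rfm Az; rewrite /A /=.
    by rewrite gtr0_norm ?subr_gt0//; lra.
apply: (le_trans (measureU2 _ (measurableC mAp) (measurableC mBm))).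
rewrite -mulrA mulr_natl mulr2n EFinD.
by apply: leeD; [exact: concentration_Bplus|exact: concentration_Bminus].
Qed.

Lemma concentration_lipschitz_deviation C c : 0 < C -> 0 < c ->
  exponential_concentration d mu C c ->
  lipschitz_deviation d mu ((2 * C + 1) * expR (2 * C + 1)) c.
Proof.
move=> C0 c0 conc f lipf.
have [m mtail] := concentration_median_tail C c f conc lipf.
(* The median bound has constant 2 C; adding 1 makes it at least 1, as the change of centre
   demands. *)
have [||fi tail] := exp_tail_mean mu f m (2 * C + 1) c (d_lip 1 f ltr01 lipf) _ c0.
- by lra.
- move=> r r0; apply: (le_trans (mtail r r0)).
  by rewrite lee_fin ler_wpM2r ?expR_ge0//; lra.
by split=> // r _; exact: tail.
Qed.

Lemma lipschitz_set_dist (A : set T) : A !=set0 ->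
  irreversible_lipschitz d 1 (set_dist d A).
Proof.
move: d_metric => [d0 _ dtri] A0 x z; rewrite mul1r.
by apply: set_dist_triangle => // a; exact: dtri.
Qed.

(** The triangle inequality bounds the decrease of the distance to [A] from [x] to [z] by [d x z],
    not its increase; the sign turns this into the one-sided Lipschitz condition. *)
Lemma lipschitz_opp_set_dist (A : set T) : A !=set0 ->
  irreversible_lipschitz d 1 (fun x => - set_dist (fun x y => d y x) A x).
Proof.
move: d_metric => [d0 _ dtri] A0 x z; rewrite mul1r addrC [- - set_dist _ _ _]opprK.
apply: (set_dist_triangle (fun x y => d y x) (fun x y => d y x)) => // a.
by rewrite addrC; exact: dtri.
Qed.

Lemma lipschitz_deviation_concentration K k : 0 < K -> 0 < k ->
  lipschitz_deviation d mu K k ->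
  exponential_concentration d mu (2 * (K + 1) ^+ 2) k.
Proof.
move=> K0 k0 dev r r0; apply: ge_ereal_sup => _ [A [mA hA] <-].
have [d0 dxx _] := d_metric.
have [mp mm] := d_nbhd A r mA r0.
(* A set of mass at least 1/2 is nonempty, so [set_dist] describes its neighbourhoods. *)
have A0 : A !=set0.
  apply/set0P/eqP => A_eq0; move: hA.
  by rewrite A_eq0 measure0 lee_fin; apply/negP; rewrite -ltNge invr_gt0.
have dev1 (f : borel -> R) : irreversible_lipschitz d 1 f ->
    (forall x, A x -> f x = 0) ->
    (mu [set x | (r <= `|f x|)%R] <= (2 * (K + 1) ^+ 2 * expR (- (k * r)))%:E)%E.
  move=> lipf fA; have [_ tail] := dev f lipf.
  (* The constant K may be below 1, so K + 1 is used; this gives 2 (K + 1)^2. *)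
  apply: (@exp_tail_zero_set _ _ _ mu f A (\int[mu]_y f y)) => //.
  - exact: d_lip lipf.
  - by rewrite lerDr ltW.
  - move=> s s0; apply: (le_trans (tail s s0)).
    by rewrite lee_fin ler_wpM2r ?expR_ge0// lerDl.
have mle (f : borel -> R) : irreversible_lipschitz d 1 f ->
    measurable [set x | r <= `|f x|].
  move=> lipf; apply: measurable_ler_fun => //.
  by apply: measurableT_comp => //; exact: d_lip lipf.
have lipp := lipschitz_set_dist A A0; have lipm := lipschitz_opp_set_dist A A0.
(* Whichever neighbourhood attains the minimum, its complement is the set where the matching
   distance is at least [r]. *)
have [_|_] := leP (mu (Bplus d A r)) (mu (Bminus d A r)).
  rewrite -(@probability_setC _ _ _ mu _ mp).
  apply: le_trans (dev1 _ lipp _); last first.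
    by move=> x Ax; apply: set_dist_in => // y; apply/dxx.
  apply: le_measure; rewrite ?inE; [exact: measurableC|exact: mle|].
  move=> x /=; rewrite Bplus_set_dist// => /negP; rewrite -leNgt => /le_trans; apply.
  exact: ler_norm.
rewrite -(@probability_setC _ _ _ mu _ mm).
apply: le_trans (dev1 _ lipm _); last first.
  by move=> x Ax; apply/eqP; rewrite oppr_eq0; apply/eqP; apply: set_dist_in => // y; apply/dxx.
apply: le_measure; rewrite ?inE; [exact: measurableC|exact: mle|].
(* Backward neighbourhoods are forward ones for the reversed distance. *)
move=> x; rewrite -[Bminus d A r]/(Bplus (fun x y => d y x) A r) /=.
rewrite Bplus_set_dist// normrN => /negP; rewrite -leNgt => /le_trans; apply.
exact: ler_norm.
Qed.

End Concentration.

Theorem theorem3p4 (R : realType) :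
  exists C' c' : R -> R,
    [/\ forall C : R, 0 < C -> 0 < C' C,
        forall c : R, 0 < c -> 0 < c' c &
        forall (T : ptopologicalType) (d : T -> T -> R)
          (mu : probability (g_sigma_algebraType (@open T)) R),
          irreversible_metric d ->
          irreversible_metric_topology d ->
          measurable_neighbourhoods d ->
          measurable_lipschitz d ->
          ((exists C c : R, [/\ 0 < C, 0 < c & exponential_concentration d mu C c])
           <-> (exists K k : R, [/\ 0 < K, 0 < k & lipschitz_deviation d mu K k]))
          /\ (forall C c : R, 0 < C -> 0 < c ->
                exponential_concentration d mu C c ->
                lipschitz_deviation d mu (C' C) (c' c))].
Proof.
have C'_gt0 (C : R) : 0 < C -> 0 < (2 * C + 1) * expR (2 * C + 1).
  by move=> C0; rewrite mulr_gt0 ?expR_gt0// addr_gt0// mulr_gt0.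
(* The change of centre keeps the rate, so [c'] is the identity. *)
exists (fun C => (2 * C + 1) * expR (2 * C + 1)), id; split=> //.
move=> T d mu d_metric _ d_nbhd d_lip; split; last first.
  by move=> C c C0 c0; exact: concentration_lipschitz_deviation.
split=> [[C [c [C0 c0 conc]]]|[K [k [K0 k0 dev]]]].
- exists ((2 * C + 1) * expR (2 * C + 1)), c; split => //; first exact: C'_gt0.
  exact: concentration_lipschitz_deviation.
- exists (2 * (K + 1) ^+ 2), k; split => //.
    by rewrite mulr_gt0// exprn_gt0// addr_gt0.
  exact: lipschitz_deviation_concentration.
Qed.
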